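(* Let $\widetilde\Gamma(x)=\frac1x e^{x\log 2}\prod_{k=1}^\infty\left(e^{-x/k}(1+x/k)\right)^{(-1)^{k+1}}$. For $0<\mathrm{Re}(x)<1$, $$\frac{\widetilde\Gamma(x)}{\widetilde\Gamma(1-x)}=\cot\left(\frac{\pi x}{2}\right).$$
   Context: In the product defining $\widetilde\Gamma$, for odd $k$ the factor is $e^{-x/k}(1+x/k)$ and for even $k$ it is its reciprocal. *)

(* Defs.v *)
From Stdlib Require Import Reals Lra Lia.
From Coquelicot Require Import Coquelicot.
Open Scope R_scope.
Open Scope C_scope.

Definition Cexp (z : C) : C :=
  RtoC (exp (Re z)) * (cos (Im z), sin (Im z)).

Definition Ccos (z : C) : C := (Cexp (Ci * z) + Cexp (- (Ci * z))) / 2.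

Definition Csin (z : C) : C := (Cexp (Ci * z) - Cexp (- (Ci * z))) / (2 * Ci).

Definition Ccot (z : C) : C := Ccos z / Csin z.

(* Total limit operator, coordinatewise like Coquelicot's [C_lim]; it returns
   the limit of every convergent sequence ([is_C_lim_seq_unique]). *)
Definition C_lim_seq (u : nat -> C) : C :=
  (real (Lim_seq (fun n => Re (u n))), real (Lim_seq (fun n => Im (u n)))).

(* The product of a 1, ..., a n; the index starts at 1. *)
Fixpoint Cprod (a : nat -> C) (n : nat) : C :=
  match n with
  | O => 1
  | S m => Cprod a m * a (S m)
  end.

Definition Cinfprod (a : nat -> C) : C := C_lim_seq (Cprod a).

Definition tGamma_base (x : C) (k : nat) : C :=
  Cexp (- (x / INR k)) * (1 + x / INR k).

(* The k-th base raised to the power (-1)^(k+1), for k >= 1. *)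
Definition tGamma_factor (x : C) (k : nat) : C :=
  if Nat.odd k then tGamma_base x k else / tGamma_base x k.

Definition tGamma (x : C) : C :=
  1 / x * Cexp (x * ln 2) * Cinfprod (tGamma_factor x).

Lemma is_C_lim_seq_unique (u : nat -> C) (l : C) :
  filterlim u eventually (locally l) -> C_lim_seq u = l.
Proof.
intros H.
assert (H1 : is_lim_seq (fun n => Re (u n)) (Re l)).
{ apply is_lim_seq_spec; intros eps.
  destruct (H (ball l eps) (locally_ball l eps)) as [N HN].
  exists N; intros n Hn; exact (proj1 (HN n Hn)). }
assert (H2 : is_lim_seq (fun n => Im (u n)) (Im l)).
{ apply is_lim_seq_spec; intros eps.
  destruct (H (ball l eps) (locally_ball l eps)) as [N HN].
  exists N; intros n Hn; exact (proj2 (HN n Hn)). }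
unfold C_lim_seq.
rewrite (is_lim_seq_unique _ _ H1), (is_lim_seq_unique _ _ H2).
destruct l; reflexivity.
Qed.

(* Main.v *)
(** The exponentials in the product cancel [exp (x ln 2)], because the
    alternating harmonic series sums to [ln 2], so that [tGamma x] is [1 / x] times the
    limit [q x] of the products [paired_prod x m] of [(1 + x/(2j-1)) / (1 + x/(2j))],
    [1 <= j <= m].

    The ratio is evaluated with Wallis-type integrals, for complex [x]: let [W n] be the
    integral of [cos t ^ n * cos (x t)] over [[0, pi/2]].  Integration by parts gives
    [(n+2)(n+1) W n = ((n+2)^2 - x^2) W (n+2)], with [x W 0 = sin (pi x / 2)] and
    [(1 - x^2) W 1 = cos (pi x / 2)].  Induction on [m] then yields the exact finite
    identity [paired_prod_cos_integral] linking [paired_prod x m],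
    [paired_prod (1 - x) m], [W (2m)] and [W (2m+1)].  Since
    [|cos (x t) - 1| <= K (sin t)^2], [W n] is asymptotic to its value at [x = 0]; hence
    [W (2m+1) / W (2m)] tends to [1], and the limit [m -> oo] of the identity is the
    reflection formula. *)

Require Import Defs.
From Stdlib Require Import Reals Lra Lia.
From Coquelicot Require Import Coquelicot.
Open Scope R_scope.

(** * Moments of the cosine on the quarter period *)

(* Real and imaginary parts of [cos ((a + i b) t)] and [sin ((a + i b) t)]. *)
Definition re_cos (a b t : R) : R := cos (a * t) * cosh (b * t).
Definition im_cos (a b t : R) : R := - (sin (a * t) * sinh (b * t)).
Definition re_sin (a b t : R) : R := sin (a * t) * cosh (b * t).
Definition im_sin (a b t : R) : R := cos (a * t) * sinh (b * t).

Lemma is_derive_re_cos a b t :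
  is_derive (re_cos a b) t (- (a * re_sin a b t - b * im_sin a b t)).
Proof.
unfold re_cos, re_sin, im_sin, cosh, sinh; auto_derive; [easy | field].
Qed.

Lemma is_derive_im_cos a b t :
  is_derive (im_cos a b) t (- (a * im_sin a b t + b * re_sin a b t)).
Proof.
unfold im_cos, re_sin, im_sin, cosh, sinh; auto_derive; [easy | field].
Qed.

Lemma is_derive_re_sin a b t :
  is_derive (re_sin a b) t (a * re_cos a b t - b * im_cos a b t).
Proof.
unfold re_cos, re_sin, im_cos, cosh, sinh; auto_derive; [easy | field].
Qed.

Lemma is_derive_im_sin a b t :
  is_derive (im_sin a b) t (a * im_cos a b t + b * re_cos a b t).
Proof.
unfold re_cos, im_sin, im_cos, cosh, sinh; auto_derive; [easy | field].
Qed.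

Definition cos_moment (f : R -> R) (n : nat) : R :=
  RInt (fun t => cos t ^ n * f t) 0 (PI / 2).

Lemma continuous_cos_pow_mult f n t :
  continuous f t -> continuous (fun t => cos t ^ n * f t) t.
Proof.
intros Hf; apply (continuous_mult (fun t => cos t ^ n) f); [|exact Hf].
apply (ex_derive_continuous (fun t => cos t ^ n)); auto_derive; easy.
Qed.

Lemma is_RInt_cos_moment f n : (forall t, continuous f t) ->
  is_RInt (fun t => cos t ^ n * f t) 0 (PI / 2) (cos_moment f n).
Proof.
intros Hf; apply (RInt_correct (V := R_CompleteNormedModule)).
apply (ex_RInt_continuous (V := R_CompleteNormedModule)).
intros t _; apply continuous_cos_pow_mult, Hf.
Qed.

Lemma continuous_re_cos a b t : continuous (re_cos a b) t.
Proof.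
apply (ex_derive_continuous (re_cos a b)); eexists; apply is_derive_re_cos.
Qed.

Lemma continuous_im_cos a b t : continuous (im_cos a b) t.
Proof.
apply (ex_derive_continuous (im_cos a b)); eexists; apply is_derive_im_cos.
Qed.

(** Common frame for the integrations by parts below: each one exhibits a primitive [G] whose
    derivative combines moment integrands. Two slots carry [f] and one carries [g], since
    multiplication by the complex [x ^ 2] couples real and imaginary parts. *)
Lemma cos_moment_FTC G f g p q r k l m :
  (forall t, continuous f t) -> (forall t, continuous g t) ->
  (forall t, is_derive G t (p * (cos t ^ k * f t) + q * (cos t ^ l * f t)
                            + r * (cos t ^ m * g t))) ->
  p * cos_moment f k + q * cos_moment f l + r * cos_moment g m
  = G (PI / 2) - G 0.
Proof.
intros Hf Hg HG.
assert (H1 : is_RInt (fun t => p * (cos t ^ k * f t) + q * (cos t ^ l * f t)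
                            + r * (cos t ^ m * g t)) 0 (PI / 2)
             (p * cos_moment f k + q * cos_moment f l + r * cos_moment g m)).
{ apply (is_RInt_plus (V := R_NormedModule)).
  apply (is_RInt_plus (V := R_NormedModule)).
  all: apply (is_RInt_scal (V := R_NormedModule)); now apply is_RInt_cos_moment. }
assert (H2 : is_RInt (fun t => p * (cos t ^ k * f t) + q * (cos t ^ l * f t)
                            + r * (cos t ^ m * g t)) 0 (PI / 2)
             (G (PI / 2) - G 0)).
{ apply (is_RInt_derive (V := R_CompleteNormedModule) G).
  - intros t _; apply HG.
  - intros t _.
    repeat apply (continuous_plus (V := R_NormedModule));
      apply (continuous_scal_r (V := R_NormedModule));
      now apply continuous_cos_pow_mult. }
rewrite <- (is_RInt_unique _ _ _ _ H1); exact (is_RInt_unique _ _ _ _ H2).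
Qed.

(** The primitive is the real part of [(n+2) cos t ^ (n+1) sin t cos (x t) - x cos t ^ (n+2) sin (x
    t)] with [x = a + i b]. On differentiating, the terms in [sin (x t)] cancel, and
    [sin t ^ 2 = 1 - cos t ^ 2] leaves only moments. *)
Lemma cos_moment_re_rec a b n :
  (INR n + 2) * (INR n + 1) * cos_moment (re_cos a b) n =
  ((INR n + 2) ^ 2 - (a * a - b * b)) * cos_moment (re_cos a b) (n + 2)
  + 2 * a * b * cos_moment (im_cos a b) (n + 2).
Proof.
set (G t := (INR n + 2) * cos t ^ (n + 1) * sin t * re_cos a b t
            - cos t ^ (n + 2) * (a * re_sin a b t - b * im_sin a b t)).
pose proof (cos_moment_FTC G (re_cos a b) (im_cos a b)
  (- ((INR n + 2) * (INR n + 1))) ((INR n + 2) ^ 2 - (a * a - b * b)) (2 * a * b)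
  n (n + 2) (n + 2)
  (continuous_re_cos a b) (continuous_im_cos a b)) as H.
(* At [PI / 2] the positive powers of the cosine vanish; at [0] every term contains a vanishing
   [sin] or [sinh]. *)
assert (HG : G (PI / 2) - G 0 = 0).
{ unfold G; rewrite cos_PI2, sin_0, !pow_i by lia.
  unfold re_sin, im_sin; rewrite !Rmult_0_r, sin_0, sinh_0; ring. }
rewrite HG in H; cut (forall x y z : R, - x + y + z = 0 -> x = y + z).
{ intros Hc; apply Hc; rewrite <- H; [ring|].
  intros t; unfold G.
  pose proof (is_derive_re_cos a b t) as D1.
  pose proof (is_derive_re_sin a b t) as D2.
  pose proof (is_derive_im_sin a b t) as D3.
  auto_derive.
  - repeat split; eexists; eassumption.
  - rewrite (is_derive_unique (fun x : R => re_cos a b x) _ _ D1), (is_derive_unique (fun x : R => re_sin a b x) _ _ D2),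
      (is_derive_unique (fun x : R => im_sin a b x) _ _ D3).
    replace (Nat.pred (n + 1)) with n by lia.
    replace (Nat.pred (n + 2)) with (n + 1)%nat by lia.
    rewrite !plus_INR, !pow_add; simpl INR; simpl pow.
    pose proof (sin2_cos2 t) as E; unfold Rsqr in E.
    assert (E' : sin t * sin t = 1 - cos t * cos t) by lra.
    ring [E']. }
intros; lra.
Qed.

(** Same argument with the imaginary part of the same primitive. *)
Lemma cos_moment_im_rec a b n :
  (INR n + 2) * (INR n + 1) * cos_moment (im_cos a b) n =
  ((INR n + 2) ^ 2 - (a * a - b * b)) * cos_moment (im_cos a b) (n + 2)
  - 2 * a * b * cos_moment (re_cos a b) (n + 2).
Proof.
set (G t := (INR n + 2) * cos t ^ (n + 1) * sin t * im_cos a b t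
            - cos t ^ (n + 2) * (a * im_sin a b t + b * re_sin a b t)).
pose proof (cos_moment_FTC G (im_cos a b) (re_cos a b)
  (- ((INR n + 2) * (INR n + 1))) ((INR n + 2) ^ 2 - (a * a - b * b)) (- (2 * a * b))
  n (n + 2) (n + 2)
  (continuous_im_cos a b) (continuous_re_cos a b)) as H.
assert (HG : G (PI / 2) - G 0 = 0).
{ unfold G; rewrite cos_PI2, sin_0, !pow_i by lia.
  unfold re_sin, im_sin; rewrite !Rmult_0_r, sin_0, sinh_0; ring. }
rewrite HG in H; cut (forall x y z : R, - x + y + - z = 0 -> x = y - z).
{ intros Hc; apply Hc; rewrite <- H; [ring|].
  intros t; unfold G.
  pose proof (is_derive_im_cos a b t) as D1.
  pose proof (is_derive_re_sin a b t) as D2.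
  pose proof (is_derive_im_sin a b t) as D3.
  auto_derive.
  - repeat split; eexists; eassumption.
  - rewrite (is_derive_unique (fun x : R => im_cos a b x) _ _ D1), (is_derive_unique (fun x : R => re_sin a b x) _ _ D2),
      (is_derive_unique (fun x : R => im_sin a b x) _ _ D3).
    replace (Nat.pred (n + 1)) with n by lia.
    replace (Nat.pred (n + 2)) with (n + 1)%nat by lia.
    rewrite !plus_INR, !pow_add; simpl INR; simpl pow.
    pose proof (sin2_cos2 t) as E; unfold Rsqr in E.
    assert (E' : sin t * sin t = 1 - cos t * cos t) by lra.
    ring [E']. }
intros; lra.
Qed.

Lemma cos_moment_0_re a b :
  a * cos_moment (re_cos a b) 0 - b * cos_moment (im_cos a b) 0
  = re_sin a b (PI / 2).
Proof.
replace (re_sin a b (PI / 2)) with (re_sin a b (PI / 2) - re_sin a b 0).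
2: { unfold re_sin; rewrite Rmult_0_r, sin_0; ring. }
rewrite <- (cos_moment_FTC (re_sin a b) (re_cos a b) (im_cos a b) a 0 (- b) 0 0 0
  (continuous_re_cos a b) (continuous_im_cos a b)); [ring|].
intros t; evar_last; [apply is_derive_re_sin | simpl; ring].
Qed.

Lemma cos_moment_0_im a b :
  a * cos_moment (im_cos a b) 0 + b * cos_moment (re_cos a b) 0
  = im_sin a b (PI / 2).
Proof.
replace (im_sin a b (PI / 2)) with (im_sin a b (PI / 2) - im_sin a b 0).
2: { unfold im_sin; rewrite !Rmult_0_r, sinh_0; ring. }
rewrite <- (cos_moment_FTC (im_sin a b) (im_cos a b) (re_cos a b) a 0 b 0 0 0
  (continuous_im_cos a b) (continuous_re_cos a b)); [ring|].
intros t; evar_last; [apply is_derive_im_sin | simpl; ring].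
Qed.

(** Here the primitive is the real part of [sin t cos (x t) - x cos t sin (x t)], whose derivative
    is that of [(1 - x ^ 2) cos t cos (x t)]; only its value at [PI / 2] survives. *)
Lemma cos_moment_1_re a b :
  (1 - (a * a - b * b)) * cos_moment (re_cos a b) 1
  + 2 * a * b * cos_moment (im_cos a b) 1 = re_cos a b (PI / 2).
Proof.
set (G t := sin t * re_cos a b t - cos t * (a * re_sin a b t - b * im_sin a b t)).
replace (re_cos a b (PI / 2)) with (G (PI / 2) - G 0).
2: { unfold G; rewrite sin_PI2, cos_PI2, sin_0; unfold re_sin, im_sin.
     rewrite !Rmult_0_r, sin_0, sinh_0; ring. }
rewrite <- (cos_moment_FTC G (re_cos a b) (im_cos a b) (1 - (a * a - b * b)) 0 (2 * a * b) 1 0 1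
  (continuous_re_cos a b) (continuous_im_cos a b)); [ring|].
intros t; unfold G.
pose proof (is_derive_re_cos a b t) as D1.
pose proof (is_derive_re_sin a b t) as D2.
pose proof (is_derive_im_sin a b t) as D3.
auto_derive; [repeat split; eexists; eassumption|].
rewrite (is_derive_unique (fun x : R => re_cos a b x) _ _ D1),
  (is_derive_unique (fun x : R => re_sin a b x) _ _ D2),
  (is_derive_unique (fun x : R => im_sin a b x) _ _ D3); simpl; ring.
Qed.

Lemma cos_moment_1_im a b :
  (1 - (a * a - b * b)) * cos_moment (im_cos a b) 1
  - 2 * a * b * cos_moment (re_cos a b) 1 = im_cos a b (PI / 2).
Proof.
set (G t := sin t * im_cos a b t - cos t * (a * im_sin a b t + b * re_sin a b t)).
replace (im_cos a b (PI / 2)) with (G (PI / 2) - G 0).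
2: { unfold G; rewrite sin_PI2, cos_PI2, sin_0; unfold re_sin, im_sin.
     rewrite !Rmult_0_r, sin_0, sinh_0; ring. }
rewrite <- (cos_moment_FTC G (im_cos a b) (re_cos a b) (1 - (a * a - b * b)) 0 (- (2 * a * b)) 1 0 1
  (continuous_im_cos a b) (continuous_re_cos a b)); [ring|].
intros t; unfold G.
pose proof (is_derive_im_cos a b t) as D1.
pose proof (is_derive_re_sin a b t) as D2.
pose proof (is_derive_im_sin a b t) as D3.
auto_derive; [repeat split; eexists; eassumption|].
rewrite (is_derive_unique (fun x : R => im_cos a b x) _ _ D1),
  (is_derive_unique (fun x : R => re_sin a b x) _ _ D2),
  (is_derive_unique (fun x : R => im_sin a b x) _ _ D3); simpl; ring.
Qed.

(** * Wallis integrals: recurrence and ratio of neighbours *)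

Definition wallis (n : nat) : R := cos_moment (fun _ => 1) n.

(** The case [x = 0] of the moment recurrence, with one factor [n + 2] cancelled. *)
Lemma wallis_rec n : (INR n + 2) * wallis (n + 2) = (INR n + 1) * wallis n.
Proof.
assert (E : forall k, wallis k = cos_moment (re_cos 0 0) k).
{ intros k; apply RInt_ext; intros t _; unfold re_cos.
  rewrite !Rmult_0_l, cos_0, cosh_0; simpl; ring. }
pose proof (cos_moment_re_rec 0 0 n) as H; rewrite <- !E in H.
pose proof (pos_INR n).
apply (Rmult_eq_reg_l (INR n + 2)); lra.
Qed.

Lemma wallis_pos n : 0 < wallis n.
Proof.
pose proof PI_RGT_0; apply RInt_gt_0; [lra| |].
- intros t Ht; rewrite Rmult_1_r; apply pow_lt, cos_gt_0; lra.
- intros t _; apply continuous_cos_pow_mult, continuous_const.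
Qed.

Lemma wallis_decr n : wallis (S n) <= wallis n.
Proof.
pose proof PI_RGT_0.
apply (is_RInt_le (fun t => cos t ^ S n * 1) (fun t => cos t ^ n * 1) 0 (PI / 2)); [lra| | |].
1, 2: apply is_RInt_cos_moment; intros; apply continuous_const.
intros t Ht; simpl; pose proof (COS_bound t); pose proof (cos_gt_0 t ltac:(lra) ltac:(lra)).
pose proof (pow_lt (cos t) n ltac:(lra)); nra.
Qed.

(** Squeeze: monotonicity gives [wallis (n+2) <= wallis (n+1) <= wallis n], and the recurrence
    bounds the ratio below by [(n+1)/(n+2)], which is at least [1 - 1/(n+1)]. *)
Lemma wallis_ratio_lim : is_lim_seq (fun n => wallis (S n) / wallis n) 1.
Proof.
apply is_lim_seq_le_le with (u := fun n => 1 - / INR (S n)) (w := fun _ => 1).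
- intros n; pose proof (wallis_pos n); pose proof (wallis_decr n).
  pose proof (wallis_decr (S n)); pose proof (wallis_rec n) as Hr.
  replace (n + 2)%nat with (S (S n)) in Hr by lia.
  rewrite S_INR; pose proof (pos_INR n).
  assert (Hi : 0 < / (INR n + 1)) by (apply Rinv_0_lt_compat; lra).
  assert (Hi1 : (INR n + 1) * / (INR n + 1) = 1) by (field; lra).
  assert (Hw : wallis (S n) / wallis n * wallis n = wallis (S n)) by (field; lra).
  split; apply (Rmult_le_reg_r (wallis n)); try lra.
  rewrite Hw; apply (Rmult_le_reg_l (INR n + 2)); [lra|].
  nra.
- replace (Finite 1) with (Finite (1 - 0)) by (f_equal; ring).
  apply is_lim_seq_minus'; [apply is_lim_seq_const|].
  apply (is_lim_seq_incr_1 (fun n => / INR n)).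
  change (Finite 0) with (Rbar_inv p_infty).
  apply is_lim_seq_inv; [apply is_lim_seq_INR | easy].
- apply is_lim_seq_const.
Qed.

(** * Comparison of the cosine moments with the Wallis integrals *)

Lemma le_3_sin t : 0 <= t <= PI / 2 -> t <= 3 * sin t.
Proof.
intros Ht; pose proof PI_4 as Hpi.
destruct (SIN t ltac:(lra) ltac:(lra)) as [H _].
unfold sin_lb, sin_approx, sin_term in H; simpl in H.
field_simplify in H.
(* With [s = t ^ 2], the product in [Hp] is three times the degree 7 Taylor lower bound of the sine,
   minus [t]. The crude bound [PI <= 4] gives [s <= 4], enough for its sign. *)
set (s := t * t).
assert (Hs : 0 <= s <= 4) by (unfold s; nra).
assert (Hp : 0 <= t * (2 - s / 2 + s ^ 2 / 40 - s ^ 3 / 1680)).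
{ apply Rmult_le_pos; [lra|]. nra. }
unfold s in Hp; lra.
Qed.

(** For [u >= 0], the inequalities [exp u >= 1 + u] and [exp (- u) >= 1 - u] give
    [sinh u <= u * exp u]; oddness handles negative arguments. *)
Lemma sinh_bound s M : Rabs s <= M -> Rabs (sinh s) <= Rabs s * exp M.
Proof.
assert (Hpos : forall u, 0 <= u -> 0 <= sinh u <= u * exp u).
{ intros u Hu; unfold sinh.
  pose proof (exp_pos u); pose proof (exp_ineq1_le u); pose proof (exp_ineq1_le (- u)).
  pose proof (exp_pos (- u)).
  assert (exp u * exp (- u) = 1) by (rewrite <- exp_plus, Rplus_opp_r; apply exp_0).
  assert (exp (- u) <= 1) by nra.
  assert (u <= u * exp u) by nra.
  assert (exp u - 1 <= u * exp u) by nra.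
  split; nra. }
intros HM; destruct (Rle_dec 0 s) as [Hs|Hs].
- rewrite (Rabs_right s) in * by lra; destruct (Hpos s Hs).
  rewrite Rabs_right by lra; apply Rle_trans with (1 := H0).
  apply Rmult_le_compat_l; [lra|]; destruct HM as [HM| ->]; [|lra].
  left; apply exp_increasing; lra.
- rewrite (Rabs_left s) in * by lra; destruct (Hpos (- s)) as [H0 H1]; [lra|].
  replace (sinh s) with (- sinh (- s)) by (unfold sinh; rewrite Ropp_involutive; field).
  rewrite Rabs_left1 by lra; rewrite Ropp_involutive; apply Rle_trans with (1 := H1).
  apply Rmult_le_compat_l; [lra|]; destruct HM as [HM| ->]; [|lra].
  left; apply exp_increasing; lra.
Qed.

Lemma Rabs_sin_le s : Rabs (sin s) <= Rabs s.
Proof.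
destruct (MVT_abs sin cos 0 s) as [c [Hc _]].
{ intros; apply derivable_pt_lim_sin. }
rewrite sin_0, !Rminus_0_r in Hc; rewrite Hc.
pose proof (Rabs_pos s); assert (Rabs (cos c) <= 1) by (apply Rabs_le, COS_bound); nra.
Qed.

(** The error is quadratic in [t]; it is stated with [sin t ^ 2] because the integral of
    [cos t ^ n * sin t ^ 2] is a difference of two Wallis integrals. *)
Lemma cos_near_1 a b : exists K, forall t, 0 <= t <= PI / 2 ->
  Rabs (re_cos a b t - 1) <= K * sin t ^ 2 /\ Rabs (im_cos a b t) <= K * sin t ^ 2.
Proof.
set (e := exp (2 * Rabs b)).
(* The [9] is the square of the constant in [le_3_sin]. The first summand bounds
   [sin (a t) * sinh (b t)]; the other two bound the half-angle terms of the real part. Since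
   [t <= 2], [e] dominates the exponentials coming from [sinh_bound]. *)
exists (9 * (Rabs a * Rabs b * e + 2 * (Rabs b * Rabs b) * (e * e) + Rabs a * Rabs a)).
intros t Ht; pose proof PI_4 as Hpi; pose proof (le_3_sin t Ht) as Hsin.
pose proof (Rabs_pos a); pose proof (Rabs_pos b).
assert (He : 0 < e) by apply exp_pos.
assert (Ht2 : t * t <= 9 * sin t ^ 2) by nra.
set (K0 := Rabs a * Rabs b * e + 2 * (Rabs b * Rabs b) * (e * e) + Rabs a * Rabs a).
assert (H1 : 0 <= Rabs a * Rabs b * e) by (repeat apply Rmult_le_pos; lra).
assert (H2 : 0 <= Rabs b * Rabs b * (e * e)) by (repeat apply Rmult_le_pos; lra).
assert (H3 : 0 <= Rabs a * Rabs a) by nra.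
assert (Hsinh : forall c, Rabs c <= Rabs b -> Rabs (sinh (c * t)) <= Rabs c * t * e).
{ intros c Hc; pose proof (Rabs_pos c).
  assert (Ect : Rabs (c * t) = Rabs c * t) by (rewrite Rabs_mult, (Rabs_right t); lra).
  rewrite <- Ect; apply sinh_bound; rewrite Ect; nra. }
assert (HK : K0 * (t * t) <= 9 * K0 * sin t ^ 2) by (unfold K0; nra).
split; apply Rle_trans with (2 := HK).
(* Split as [(cos (a t) - 1) + cos (a t) * (cosh (b t) - 1)] and apply the half-angle formulas, so
   that both terms are visibly quadratic. *)
- assert (Hc : re_cos a b t - 1 = - (2 * sin (a / 2 * t) ^ 2)
      + cos (a * t) * (2 * sinh (b / 2 * t) ^ 2)).
  { unfold re_cos; replace (a * t) with (2 * (a / 2 * t)) by field.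
    replace (b * t) with (b / 2 * t + b / 2 * t) by field.
    rewrite cos_2a_sin; unfold cosh, sinh; rewrite Ropp_plus_distr, !exp_plus.
    assert (H4 : exp (b / 2 * t) * exp (- (b / 2 * t)) = 1)
      by (rewrite <- exp_plus, Rplus_opp_r; apply exp_0).
    set (p := exp (b / 2 * t)) in *; set (q := exp (- (b / 2 * t))) in *.
    set (w := sin (a / 2 * t)).
    replace (2 * ((p - q) / 2) ^ 2) with ((p * p + q * q) / 2 - p * q) by field.
    rewrite H4; field. }
  rewrite Hc.
  assert (Hs : sin (a / 2 * t) ^ 2 <= Rabs a * Rabs a * (t * t) / 4).
  { rewrite <- pow2_abs.
    assert (Hl : Rabs (sin (a / 2 * t)) <= Rabs a * t / 2).
    { apply Rle_trans with (1 := Rabs_sin_le _).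
      unfold Rdiv; rewrite !Rabs_mult, (Rabs_right t), (Rabs_right (/ 2)); lra. }
    pose proof (Rabs_pos (sin (a / 2 * t))); nra. }
  assert (Hsh : sinh (b / 2 * t) ^ 2 <= Rabs b * Rabs b * (e * e) * (t * t) / 4).
  { assert (Hb : Rabs (b / 2) = Rabs b / 2)
      by (unfold Rdiv; rewrite Rabs_mult, (Rabs_right (/ 2)); lra).
    rewrite <- pow2_abs; pose proof (Hsinh (b / 2) ltac:(lra)) as Hl.
    rewrite Hb in Hl; pose proof (Rabs_pos (sinh (b / 2 * t))) as Hp.
    pose proof (Rmult_le_compat _ _ _ _ Hp Hp Hl Hl); nra. }
  pose proof (COS_bound (a * t)); pose proof (pow2_ge_0 (sin (a / 2 * t))).
  pose proof (pow2_ge_0 (sinh (b / 2 * t))).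
  assert (0 <= Rabs a * Rabs b * e * (t * t)) by (apply Rmult_le_pos; nra).
  assert (0 <= Rabs b * Rabs b * (e * e) * (t * t)) by (apply Rmult_le_pos; nra).
  assert (0 <= Rabs a * Rabs a * (t * t)) by (apply Rmult_le_pos; nra).
  assert (- (2 * sinh (b / 2 * t) ^ 2) <= cos (a * t) * (2 * sinh (b / 2 * t) ^ 2)
          <= 2 * sinh (b / 2 * t) ^ 2) by nra.
  unfold K0; apply Rabs_le; lra.
- unfold im_cos; rewrite Rabs_Ropp, Rabs_mult.
  pose proof (Hsinh b ltac:(lra)) as Hl.
  pose proof (Rabs_sin_le (a * t)) as Hs; rewrite Rabs_mult, (Rabs_right t) in Hs by lra.
  pose proof (Rmult_le_compat _ _ _ _ (Rabs_pos _) (Rabs_pos _) Hs Hl).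
  assert (0 <= (2 * (Rabs b * Rabs b) * (e * e) + Rabs a * Rabs a) * (t * t))
    by (apply Rmult_le_pos; nra).
  unfold K0; lra.
Qed.

(** Integrating [l - K sin t ^ 2 <= f t <= l + K sin t ^ 2] against [cos t ^ n] gives an error of
    [K * (wallis n - wallis (n+2))], which the recurrence turns into [K * wallis n / (n+2)]. *)
Lemma cos_moment_near f l K n : (forall t, continuous f t) ->
  (forall t, 0 <= t <= PI / 2 -> Rabs (f t - l) <= K * sin t ^ 2) ->
  Rabs (cos_moment f n / wallis n - l) <= K / (INR n + 2).
Proof.
intros Hf Hl; pose proof PI_RGT_0; pose proof (wallis_pos n) as Hw; pose proof (pos_INR n).
assert (Hc : forall c : R, forall t : R, continuous (fun _ : R => c) t)
  by (intros; apply continuous_const).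
(* The sign [s], later [1] and [-1], treats the upper and lower bounding functions together;
   [sin t ^ 2] is expanded as [1 - cos t ^ 2]. *)
assert (Hd : forall s, is_RInt (fun t => (l + s * K) * (cos t ^ n * 1)
                                        - s * K * (cos t ^ (n + 2) * 1)) 0 (PI / 2)
          ((l + s * K) * wallis n - s * K * wallis (n + 2))).
{ intros s; apply (is_RInt_minus (V := R_NormedModule));
    apply (is_RInt_scal (V := R_NormedModule)); now apply is_RInt_cos_moment. }
assert (Hr : K * wallis n - K * wallis (n + 2) = K / (INR n + 2) * wallis n).
{ pose proof (wallis_rec n) as Hr.
  replace (wallis (n + 2)) with ((INR n + 1) * wallis n / (INR n + 2))
    by (rewrite <- Hr; field; lra).
  field; lra. }
assert (Hpt : forall t, 0 < t < PI / 2 -> 0 < cos t ^ n /\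
   cos t ^ (n + 2) = cos t ^ n * (1 - sin t ^ 2)).
{ intros t Ht; split; [apply pow_lt, cos_gt_0; lra|].
  rewrite pow_add; f_equal; pose proof (sin2_cos2 t); unfold Rsqr in *; lra. }
assert (Hu : cos_moment f n <= (l + 1 * K) * wallis n - 1 * K * wallis (n + 2)).
{ refine (is_RInt_le _ _ 0 (PI / 2) _ _ _ (is_RInt_cos_moment f n Hf) (Hd 1) _); [lra|].
  intros t Ht; destruct (Hpt t Ht) as [Hp ->].
  pose proof (Hl t ltac:(lra)) as Hb; apply Rabs_le_between in Hb.
  apply Rle_trans with (cos t ^ n * (l + K * sin t ^ 2)); [nra|right; ring]. }
assert (Hlo : (l + -1 * K) * wallis n - -1 * K * wallis (n + 2) <= cos_moment f n).
{ refine (is_RInt_le _ _ 0 (PI / 2) _ _ _ (Hd (-1)) (is_RInt_cos_moment f n Hf) _); [lra|].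
  intros t Ht; destruct (Hpt t Ht) as [Hp ->].
  pose proof (Hl t ltac:(lra)) as Hb; apply Rabs_le_between in Hb.
  apply Rle_trans with (cos t ^ n * (l - K * sin t ^ 2)); [right; ring|nra]. }
assert (Hm : cos_moment f n / wallis n * wallis n = cos_moment f n) by (field; lra).
apply Rabs_le; split; apply (Rmult_le_reg_r (wallis n)); lra.
Qed.

Lemma is_lim_seq_of_bound (u : nat -> R) (l K : R) :
  (forall n, Rabs (u n - l) <= K / (INR n + 2)) -> is_lim_seq u l.
Proof.
intros H.
assert (H0 : forall c : R, is_lim_seq (fun n => l + c / (INR n + 2)) l).
{ intros c; replace (Finite l) with (Finite (l + 0)) by (f_equal; ring).
  apply is_lim_seq_plus'; [apply is_lim_seq_const|].
  replace (Finite 0) with (Rbar_mult c (Rbar_inv p_infty)) by (simpl; f_equal; ring).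
  apply is_lim_seq_scal_l, is_lim_seq_inv; [|easy].
  apply is_lim_seq_plus with p_infty 2; [apply is_lim_seq_INR | apply is_lim_seq_const | easy]. }
apply is_lim_seq_le_le with (2 := H0 (- K)) (3 := H0 K).
intros n; pose proof (H n) as Hn; apply Rabs_le_between in Hn.
unfold Rdiv in *; lra.
Qed.

Lemma cos_moment_re_lim a b :
  is_lim_seq (fun n => cos_moment (re_cos a b) n / wallis n) 1.
Proof.
destruct (cos_near_1 a b) as [K HK]; apply is_lim_seq_of_bound with K; intros n.
apply cos_moment_near; [apply continuous_re_cos | intros t Ht; apply HK, Ht].
Qed.

Lemma cos_moment_im_lim a b :
  is_lim_seq (fun n => cos_moment (im_cos a b) n / wallis n) 0.
Proof.
destruct (cos_near_1 a b) as [K HK]; apply is_lim_seq_of_bound with K; intros n.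
apply cos_moment_near; [apply continuous_im_cos | intros t Ht].
rewrite Rminus_0_r; apply HK, Ht.
Qed.

Lemma is_lim_seq_inv_nat : is_lim_seq (fun n => / (INR n + 1)) 0.
Proof.
change (Finite 0) with (Rbar_inv p_infty); apply is_lim_seq_inv; [|easy].
apply is_lim_seq_plus with p_infty 1; [apply is_lim_seq_INR | apply is_lim_seq_const | easy].
Qed.

Open Scope C_scope.

(** * Convergence of complex sequences and products *)

(** Coordinatewise, to match [C_lim_seq] and to inherit the limit theorems for real sequences. *)
Definition Clim (u : nat -> C) (l : C) : Prop :=
  is_lim_seq (fun n => Re (u n)) (Re l) /\ is_lim_seq (fun n => Im (u n)) (Im l).

Lemma Clim_const c : Clim (fun _ => c) c.
Proof. split; apply is_lim_seq_const. Qed.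

Lemma Clim_ext u v l : (forall n, u n = v n) -> Clim u l -> Clim v l.
Proof.
intros E [H1 H2]; split; [revert H1 | revert H2];
  apply is_lim_seq_ext; intros n; now rewrite E.
Qed.

Lemma Clim_plus u v l m : Clim u l -> Clim v m -> Clim (fun n => u n + v n) (l + m).
Proof. intros [H1 H2] [H3 H4]; split; simpl; now apply is_lim_seq_plus'. Qed.

Lemma Clim_mult u v l m : Clim u l -> Clim v m -> Clim (fun n => u n * v n) (l * m).
Proof.
intros [H1 H2] [H3 H4]; split; simpl.
- apply is_lim_seq_minus'; now apply is_lim_seq_mult'.
- apply is_lim_seq_plus'; now apply is_lim_seq_mult'.
Qed.

Lemma Clim_unique u l m : Clim u l -> Clim u m -> l = m.
Proof.
intros [H1 H2] [H3 H4].
apply is_lim_seq_unique in H1, H2, H3, H4.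
rewrite H1 in H3; rewrite H2 in H4; injection H3; injection H4.
destruct l, m; simpl; congruence.
Qed.

Lemma C_lim_seq_Clim u l : Clim u l -> C_lim_seq u = l.
Proof.
intros [H1 H2]; unfold C_lim_seq.
rewrite (is_lim_seq_unique _ _ H1), (is_lim_seq_unique _ _ H2); now destruct l.
Qed.

Lemma Clim_RtoC u (l : R) : is_lim_seq u l -> Clim (fun n => RtoC (u n)) l.
Proof. intros H; split; simpl; [exact H | apply is_lim_seq_const]. Qed.

Lemma Clim_Cexp u l : Clim u l -> Clim (fun n => Cexp (u n)) (Cexp l).
Proof.
intros [H1 H2]; apply Clim_mult.
- apply Clim_RtoC, is_lim_seq_continuous; [|exact H1].
  apply derivable_continuous_pt, derivable_pt_exp.
- split; simpl; apply is_lim_seq_continuous; try exact H2.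
  + apply continuity_cos.
  + apply continuity_sin.
Qed.

Lemma is_lim_seq_even_odd (u : nat -> R) (l : R) :
  is_lim_seq (fun n => u (2 * n)%nat) l ->
  is_lim_seq (fun n => u (2 * n + 1)%nat) l -> is_lim_seq u l.
Proof.
intros H0 H1; apply is_lim_seq_spec; intros eps.
apply is_lim_seq_spec in H0, H1.
destruct (H0 eps) as [N0 HN0]; destruct (H1 eps) as [N1 HN1].
exists (2 * N0 + 2 * N1)%nat; intros n Hn.
destruct (Nat.Even_or_Odd n) as [[k ->]|[k ->]]; [apply HN0 | apply HN1]; lia.
Qed.

Lemma Clim_even_odd u l : Clim (fun n => u (2 * n)%nat) l ->
  Clim (fun n => u (2 * n + 1)%nat) l -> Clim u l.
Proof.
intros [H1 H2] [H3 H4]; split.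
- now apply (is_lim_seq_even_odd (fun n => Re (u n))).
- now apply (is_lim_seq_even_odd (fun n => Im (u n))).
Qed.

Lemma im_le_Cmod (z : C) : (Rabs (Im z) <= Cmod z)%R.
Proof. exact (Rle_trans _ _ _ (Rmax_r _ _) (Rmax_Cmod z)). Qed.

Lemma Re_pos_neq_0 (z : C) : (0 < Re z)%R -> z <> 0.
Proof. intros H E; rewrite E in H; simpl in H; lra. Qed.

(** The bound equals [M/(n+1) - M/(n+2)], so [u n - M/(n+1)] increases while [u n + M/(n+1)]
    decreases: the first is monotone and bounded, and the correction tends to [0]. *)
Lemma ex_lim_of_telescoping_increments (u : nat -> R) (M : R) :
  (forall n, Rabs (u (S n) - u n) <= M / ((INR n + 1) * (INR n + 2)))%R ->
  exists l : R, is_lim_seq u l.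
Proof.
intros H.
assert (HM : (0 <= M)%R).
{ pose proof (H O) as H0; simpl in H0; pose proof (Rabs_pos (u 1%nat - u O)); lra. }
assert (Ht : forall n, (M / ((INR n + 1) * (INR n + 2)) = M / (INR n + 1) - M / (INR n + 2))%R).
{ intros n; pose proof (pos_INR n); field; lra. }
assert (Hs : forall n, INR (S n) = (INR n + 1)%R) by apply S_INR.
set (v := fun n => (u n - M / (INR n + 1))%R).
assert (Hv : forall n, (v n <= v (S n))%R).
{ intros n; unfold v; rewrite Hs; pose proof (H n) as Hn; rewrite Ht in Hn.
  apply Rabs_le_between in Hn.
  replace (INR n + 1 + 1)%R with (INR n + 2)%R by ring; lra. }
assert (Hw : forall n, (u n + M / (INR n + 1) <= u O + M)%R).
{ induction n as [|n IH]; [simpl; lra|].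
  rewrite Hs; pose proof (H n) as Hn; rewrite Ht in Hn; apply Rabs_le_between in Hn.
  replace (INR n + 1 + 1)%R with (INR n + 2)%R by ring; lra. }
assert (Hinv : forall n, (0 <= M / (INR n + 1))%R).
{ intros n; apply Rdiv_le_0_compat; [lra|]; pose proof (pos_INR n); lra. }
destruct (ex_finite_lim_seq_incr v (u O + M)%R Hv) as [l Hl].
{ intros n; unfold v; pose proof (Hw n); pose proof (Hinv n); lra. }
exists (l + M * 0)%R.
apply is_lim_seq_ext with (fun n => v n + M * / (INR n + 1))%R.
{ intros n; unfold v, Rdiv; ring. }
apply is_lim_seq_plus'; [exact Hl|].
apply is_lim_seq_mult'; [apply is_lim_seq_const|].
apply is_lim_seq_inv_nat.
Qed.

Lemma Cprod_S a n : Cprod a (S n) = Cprod a n * a (S n).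
Proof. reflexivity. Qed.

(** The partial products stay bounded, hence their increments [P n * a (S n)] inherit the
    telescoping bound on [a]. *)
Lemma Cprod_ex_lim (a : nat -> C) (K : R) :
  (forall n, Cmod (a (S n)) <= K / ((INR n + 1) * (INR n + 2)))%R ->
  exists l, Clim (Cprod (fun j => 1 + a j)) l.
Proof.
intros Ha.
assert (HK : (0 <= K)%R).
{ pose proof (Ha O) as H0; simpl in H0; pose proof (Cmod_ge_0 (a 1%nat)); lra. }
set (P := Cprod (fun j => 1 + a j)).
assert (HS : forall n, P (S n) - P n = P n * a (S n)) by (intros n; unfold P; rewrite Cprod_S; ring).
(* The exponent is the telescoped sum of the bounds on the first [n] terms; each factor is handled
   by [1 + y <= exp y]. *)
assert (Hb : forall n, (Cmod (P n) <= exp (K - K / (INR n + 1)))%R).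
{ induction n as [|n IH].
  - unfold P; simpl; rewrite Cmod_1.
    replace (K - K / (0 + 1))%R with 0%R by field; rewrite exp_0; lra.
  - replace (P (S n)) with (P n * (1 + a (S n))) by (unfold P; now rewrite Cprod_S).
    rewrite Cmod_mult.
    pose proof (pos_INR n); pose proof (Ha n).
    replace (K - K / (INR (S n) + 1))%R
      with ((K - K / (INR n + 1)) + K / ((INR n + 1) * (INR n + 2)))%R
      by (rewrite S_INR; field; lra).
    rewrite exp_plus; apply Rmult_le_compat; try apply Cmod_ge_0; [exact IH|].
    apply Rle_trans with (1 := Cmod_triangle _ _); rewrite Cmod_1.
    apply Rle_trans with (2 := exp_ineq1_le _); lra. }
assert (Hd : forall n, (Cmod (P (S n) - P n) <= exp K * K / ((INR n + 1) * (INR n + 2)))%R).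
{ intros n; rewrite HS, Cmod_mult; unfold Rdiv; rewrite Rmult_assoc.
  apply Rmult_le_compat; try apply Cmod_ge_0; [|apply Ha].
  apply Rle_trans with (1 := Hb n).
  assert (0 <= K / (INR n + 1))%R
    by (apply Rdiv_le_0_compat; [lra|]; pose proof (pos_INR n); lra).
  destruct (Req_dec (K / (INR n + 1)) 0) as [E|E];
    [rewrite E, Rminus_0_r; lra | left; apply exp_increasing; lra]. }
destruct (ex_lim_of_telescoping_increments (fun n => Re (P n)) (exp K * K)) as [l1 H1].
{ intros n; apply Rle_trans with (2 := Hd n); exact (re_le_Cmod (P (S n) - P n)). }
destruct (ex_lim_of_telescoping_increments (fun n => Im (P n)) (exp K * K)) as [l2 H2].
{ intros n; apply Rle_trans with (2 := Hd n); exact (im_le_Cmod (P (S n) - P n)). }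
exists (l1, l2); split; assumption.
Qed.

(* The product of the factors [(1 + x/(2j-1)) / (1 + x/(2j))]. *)
Definition paired_prod (x : C) : nat -> C :=
  Cprod (fun j => 1 + x / ((2 * INR j - 1) * (2 * INR j + x))).

(** A convergent product could still tend to [0]; this is excluded by showing that the product of
    the reciprocal factors converges too. *)
Lemma paired_prod_lim (x : C) : (0 < Re x)%R ->
  exists q : C, q <> 0 /\ Clim (paired_prod x) q.
Proof.
intros Hx.
assert (Hs : forall n, RtoC (INR (S n)) = INR n + 1) by (intros n; rewrite S_INR; apply RtoC_plus).
(* With [j = n + 1], both products have denominators of this kind, and
   [(2n+1)(2n+2) >= (n+1)(n+2)]. *)
assert (Hmod : forall (y z : C) (n : nat),
  (2 * INR n + 1 <= Re y)%R -> (2 * INR n + 1 <= Re z)%R ->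
  (2 * INR n + 2 <= Re y \/ 2 * INR n + 2 <= Re z)%R ->
  (Cmod (x / (y * z)) <= Cmod x / ((INR n + 1) * (INR n + 2)))%R).
{ intros y z n Hy Hz Hyz; pose proof (pos_INR n).
  rewrite Cmod_div by (apply Cmult_neq_0; apply Re_pos_neq_0; lra).
  rewrite Cmod_mult.
  apply Rmult_le_compat_l; [apply Cmod_ge_0|].
  pose proof (Rle_trans _ _ _ (Rle_abs _) (re_le_Cmod y)).
  pose proof (Rle_trans _ _ _ (Rle_abs _) (re_le_Cmod z)).
  apply Rinv_le_contravar; [nra|].
  destruct Hyz.
  - apply Rle_trans with ((2 * INR n + 2) * (2 * INR n + 1))%R; [nra|].
    apply Rmult_le_compat; lra.
  - apply Rle_trans with ((2 * INR n + 1) * (2 * INR n + 2))%R; [nra|].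
    apply Rmult_le_compat; lra. }
destruct (Cprod_ex_lim (fun j => x / ((2 * INR j - 1) * (2 * INR j + x))) (Cmod x)) as [q Hq].
{ intros n; pose proof (pos_INR n); apply Hmod; rewrite Hs; unfold Re in *; simpl; lra. }
(* The factor [1 - x / (2j (2j-1+x))] is the inverse of [1 + x / ((2j-1)(2j+x))]. *)
destruct (Cprod_ex_lim (fun j => - (x / ((2 * INR j) * (2 * INR j - 1 + x)))) (Cmod x)) as [q' Hq'].
{ intros n; pose proof (pos_INR n).
  rewrite Cmod_opp; apply Hmod; rewrite Hs; unfold Re in *; simpl; lra. }
assert (E : q * q' = 1).
{ apply (Clim_unique _ _ _ (Clim_mult _ _ _ _ Hq Hq')).
  apply Clim_ext with (2 := Clim_const 1).
  induction n as [|n IH]; [simpl; ring|].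
  rewrite !Cprod_S, Hs.
  match goal with |- _ = ?A * ?f * (?B * ?g) =>
    replace (A * f * (B * g)) with (A * B * (f * g)) by ring end.
  rewrite <- IH; pose proof (pos_INR n).
  field; repeat split; apply Re_pos_neq_0; unfold Re in *; simpl; lra. }
exists q; split; [|exact Hq].
intros Z; rewrite Z, Cmult_0_l in E.
apply (f_equal Re) in E; simpl in E; lra.
Qed.

(** * The cosine integrals for complex parameter *)

Lemma Cexp_plus z w : Cexp (z + w) = Cexp z * Cexp w.
Proof.
destruct z, w; unfold Cexp; simpl; rewrite exp_plus, cos_plus, sin_plus.
apply injective_projections; simpl; ring.
Qed.

Lemma Cexp_0 : Cexp 0 = 1.
Proof.
unfold Cexp; simpl; rewrite exp_0, cos_0, sin_0.
apply injective_projections; simpl; ring.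
Qed.

Lemma Cexp_opp_r z : Cexp z * Cexp (- z) = 1.
Proof. rewrite <- Cexp_plus, Cplus_opp_r; apply Cexp_0. Qed.

Lemma Cexp_neq_0 z : Cexp z <> 0.
Proof.
intros E; pose proof (Cexp_opp_r z) as H; rewrite E, Cmult_0_l in H.
apply (f_equal Re) in H; simpl in H; lra.
Qed.

Lemma Cinv_Cexp z : / Cexp z = Cexp (- z).
Proof.
rewrite <- (Cmult_1_l (/ Cexp z)), <- (Cexp_opp_r z).
field; apply Cexp_neq_0.
Qed.

Lemma Ccos2_Csin2 z : Ccos z * Ccos z + Csin z * Csin z = 1.
Proof.
unfold Ccos, Csin; rewrite <- (Cexp_opp_r (Ci * z)).
assert (HC : Ci * Ci = - (1)) by (apply injective_projections; simpl; ring).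
assert (H2 : RtoC 2 <> 0) by (apply Re_pos_neq_0; simpl; lra).
set (p := Cexp (Ci * z)); set (q := Cexp (- (Ci * z))).
(* [field] does not know that [Ci] squares to [-1], so the two copies are gathered for [HC]. *)
replace ((p - q) / (2 * Ci) * ((p - q) / (2 * Ci)))
  with ((p - q) * (p - q) / (2 * 2 * (Ci * Ci))) by (field; repeat split; exact H2 || exact Ci_nz).
rewrite HC; field; exact H2.
Qed.

Lemma Cexp_Ci_mult (a b t : R) :
  Cexp (Ci * (RtoC t * (a, b))) =
  (exp (- (b * t)) * cos (a * t), exp (- (b * t)) * sin (a * t))%R.
Proof.
unfold Cexp, Ci; simpl.
replace (0 * (t * a - 0 * b) - 1 * (t * b + 0 * a))%R with (- (b * t))%R by ring.
replace (0 * (t * b + 0 * a) + 1 * (t * a - 0 * b))%R with (a * t)%R by ring.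
apply injective_projections; simpl; ring.
Qed.

Lemma Cexp_opp_Ci_mult (a b t : R) :
  Cexp (- (Ci * (RtoC t * (a, b)))) =
  (exp (b * t) * cos (a * t), - (exp (b * t) * sin (a * t)))%R.
Proof.
replace (- (Ci * (RtoC t * (a, b)))) with (Ci * (RtoC (- t) * (a, b)))
  by (rewrite RtoC_opp; ring).
rewrite Cexp_Ci_mult, !Ropp_mult_distr_r_reverse, Ropp_involutive, cos_neg, sin_neg.
apply injective_projections; simpl; ring.
Qed.

Lemma Ccos_re_im (a b t : R) : Ccos (t * (a, b)) = (re_cos a b t, im_cos a b t).
Proof.
unfold Ccos; rewrite Cexp_Ci_mult, Cexp_opp_Ci_mult.
unfold re_cos, im_cos, cosh, sinh; apply injective_projections; simpl; field.
Qed.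

Lemma Csin_re_im (a b t : R) : Csin (t * (a, b)) = (re_sin a b t, im_sin a b t).
Proof.
unfold Csin; rewrite Cexp_Ci_mult, Cexp_opp_Ci_mult.
unfold re_sin, im_sin, cosh, sinh, Ci; apply injective_projections; simpl; field.
Qed.

(* [cos_integral x n] is the integral of [cos t ^ n * cos (x t)] over [0, pi/2]. *)
Definition cos_integral (x : C) (n : nat) : C :=
  (cos_moment (re_cos (Re x) (Im x)) n, cos_moment (im_cos (Re x) (Im x)) n).

Lemma cos_integral_rec x n :
  (INR n + 2) * (INR n + 1) * cos_integral x n =
  ((INR n + 2) * (INR n + 2) - x * x) * cos_integral x (n + 2).
Proof.
pose proof (cos_moment_re_rec (Re x) (Im x) n) as H1.
pose proof (cos_moment_im_rec (Re x) (Im x) n) as H2.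
unfold cos_integral; destruct x as [a b]; unfold Re, Im in *; simpl in *.
apply injective_projections; simpl; lra.
Qed.

Lemma cos_integral_0 x : x * cos_integral x 0 = Csin (PI * x / 2).
Proof.
pose proof (cos_moment_0_re (Re x) (Im x)) as H1.
pose proof (cos_moment_0_im (Re x) (Im x)) as H2.
replace (PI * x / 2) with (RtoC (PI / 2) * (Re x, Im x)).
2: { destruct x; apply injective_projections; simpl; field. }
rewrite Csin_re_im, <- H1, <- H2; unfold cos_integral.
destruct x; apply injective_projections; simpl; ring.
Qed.

Lemma cos_integral_1 x : (1 - x * x) * cos_integral x 1 = Ccos (PI * x / 2).
Proof.
pose proof (cos_moment_1_re (Re x) (Im x)) as H1.
pose proof (cos_moment_1_im (Re x) (Im x)) as H2.
replace (PI * x / 2) with (RtoC (PI / 2) * (Re x, Im x)).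
2: { destruct x; apply injective_projections; simpl; field. }
rewrite Ccos_re_im, <- H1, <- H2; unfold cos_integral.
destruct x; apply injective_projections; simpl; ring.
Qed.

Lemma cos_integral_lim x : Clim (fun n => cos_integral x n / wallis n) 1.
Proof.
apply Clim_ext with (fun n => (cos_moment (re_cos (Re x) (Im x)) n / wallis n,
                               cos_moment (im_cos (Re x) (Im x)) n / wallis n)%R).
{ intros n; pose proof (wallis_pos n).
  apply injective_projections; simpl; field; lra. }
split; simpl; [apply cos_moment_re_lim | apply cos_moment_im_lim].
Qed.

Lemma is_lim_seq_double (u : nat -> R) (l : R) :
  is_lim_seq u l -> is_lim_seq (fun n => u (2 * n)%nat) l.
Proof.
apply is_lim_seq_subseq; apply eventually_subseq; intros n; lia.
Qed.

Lemma Clim_double u l : Clim u l -> Clim (fun n => u (2 * n)%nat) l.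
Proof.
intros [H1 H2]; split.
- now apply (is_lim_seq_double (fun n => Re (u n))).
- now apply (is_lim_seq_double (fun n => Im (u n))).
Qed.

Lemma Clim_S u l : Clim u l -> Clim (fun n => u (S n)) l.
Proof.
intros [H1 H2]; split.
- now apply (is_lim_seq_incr_1 (fun n => Re (u n))).
- now apply (is_lim_seq_incr_1 (fun n => Im (u n))).
Qed.

(** The odd integral is normalised by the even Wallis integral so that both sides of the finite
    identity can be divided by the same number. *)
Lemma cos_integral_odd_lim x :
  Clim (fun m => cos_integral x (2 * m + 1) / wallis (2 * m)) 1.
Proof.
replace (RtoC 1) with (RtoC 1 * RtoC 1) by ring.
apply Clim_ext with (fun m => cos_integral x (S (2 * m)) / wallis (S (2 * m))
                              * (wallis (S (2 * m)) / wallis (2 * m))%R).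
{ intros m; pose proof (wallis_pos (2 * m)); pose proof (wallis_pos (S (2 * m))).
  replace (2 * m + 1)%nat with (S (2 * m)) by lia.
  rewrite RtoC_div by lra; field.
  split; apply Re_pos_neq_0; rewrite re_RtoC; assumption. }
apply Clim_mult.
- apply (Clim_double (fun m => cos_integral x (S m) / wallis (S m))).
  apply (Clim_S (fun m => cos_integral x m / wallis m)), cos_integral_lim.
- apply (Clim_RtoC (fun m => wallis (S (2 * m)) / wallis (2 * m))%R).
  apply (is_lim_seq_double (fun m => wallis (S m) / wallis m)%R), wallis_ratio_lim.
Qed.

(** At [m = 0] both sides equal [sin (pi x / 2) * cos (pi x / 2)]. The linear factors [2m+1+x] and
    [2m+1] are chosen so that passing to [m + 1] multiplies both sides by the same rational
    function. *)
Lemma paired_prod_cos_integral (x : C) (m : nat) : (0 < Re x < 1)%R ->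
  (1 - x) * paired_prod x m * cos_integral x (2 * m + 1) * (2 * INR m + 1 + x)
    * Csin (PI * x / 2) =
  x * paired_prod (1 - x) m * cos_integral x (2 * m) * (2 * INR m + 1)
    * Ccos (PI * x / 2).
Proof.
intros Hx; induction m as [|m IH].
- rewrite <- cos_integral_0, <- cos_integral_1; unfold paired_prod; simpl.
  ring.
- unfold paired_prod in *; rewrite !Cprod_S.
  pose proof (cos_integral_rec x (2 * m)) as R0.
  pose proof (cos_integral_rec x (2 * m + 1)) as R1.
  replace (2 * S m)%nat with (2 * m + 2)%nat by lia.
  replace (2 * m + 2 + 1)%nat with (2 * m + 1 + 2)%nat by lia.
  rewrite plus_INR, mult_INR in R1; rewrite mult_INR in R0.
  rewrite S_INR; simpl (INR 2) in *; simpl (INR 1) in *.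
  replace (1 + 1)%R with 2%R in * by ring.
  rewrite !RtoC_plus, !RtoC_mult in *.
  pose proof (pos_INR m) as Hm.
  set (M := RtoC (INR m)) in *.
  assert (HM : (0 <= Re M)%R) by exact Hm.
  assert (HMi : Im M = 0%R) by reflexivity.
  clearbody M.
  set (P := Cprod _ m) in *; set (P' := Cprod _ m) in *.
  set (s := Csin _) in *; set (c := Ccos _) in *.
  assert (N1 : 2 * M + 2 + x <> 0) by (apply Re_pos_neq_0; unfold Re in *; simpl; lra).
  assert (N2 : 2 * M + 2 - x <> 0) by (apply Re_pos_neq_0; unfold Re in *; simpl; lra).
  assert (N3 : 2 * M + 3 - x <> 0) by (apply Re_pos_neq_0; unfold Re in *; simpl; lra).
  assert (N4 : 2 * M + 3 + x <> 0) by (apply Re_pos_neq_0; unfold Re in *; simpl; lra).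
  assert (N5 : 2 * M + 1 <> 0) by (apply Re_pos_neq_0; unfold Re in *; simpl; lra).
  assert (N6 : 2 * M + 1 + x <> 0) by (apply Re_pos_neq_0; unfold Re in *; simpl; lra).
  assert (E0 : cos_integral x (2 * m + 2) =
    (2 * M + 2) * (2 * M + 1) * cos_integral x (2 * m) / ((2 * M + 2 + x) * (2 * M + 2 - x))).
  { rewrite R0; field; auto. }
  assert (E1 : cos_integral x (2 * m + 1 + 2) =
    (2 * M + 3) * (2 * M + 2) * cos_integral x (2 * m + 1) / ((2 * M + 3 + x) * (2 * M + 3 - x))).
  { replace ((2 * M + 3) * (2 * M + 2)) with ((2 * M + 1 + 2) * (2 * M + 1 + 1)) by ring.
    rewrite R1; field; auto. }
  rewrite E0, E1.
  (* The last factor is that common multiplier, read off the left side; it remains to recognise it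
     on the right after [IH]. *)
  transitivity ((1 - x) * P * cos_integral x (2 * m + 1) * (2 * M + 1 + x) * s
    * ((2 * M + 2) * (2 * M + 3) * (2 * M + 2)
       / ((2 * M + 1) * (2 * M + 2 + x) * (2 * M + 3 - x)))).
  { field; repeat split; auto.
    all: apply Re_pos_neq_0; unfold Re in *; simpl; lra. }
  rewrite IH; field; repeat split; auto.
  all: apply Re_pos_neq_0; unfold Re in *; simpl; lra.
Qed.

(** * Reduction of the Gamma-like function to the paired product *)

Fixpoint harmonic (n : nat) : R :=
  match n with O => 0 | S m => harmonic m + / INR (S m) end%R.

(** Sum of [1/(y+1) <= ln ((y+1)/y) <= 1/y] over consecutive [y]; the logarithms telescope. *)
Lemma harmonic_increment_bounds m k :
  (ln ((INR (S m) + INR k + 1) / (INR (S m) + 1)) <= harmonic (S m + k) - harmonic (S m)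
   <= ln ((INR (S m) + INR k) / INR (S m)))%R.
Proof.
set (M := INR (S m)); assert (HM : (0 < M)%R) by (apply lt_0_INR; lia).
assert (Hln : forall y, (0 < y -> / (y + 1) <= ln ((y + 1) / y) <= / y)%R).
{ intros y Hy; assert (Hi : (0 < / y)%R) by now apply Rinv_0_lt_compat.
  split.
  - assert (E : ((y + 1) / y = / (y / (y + 1)))%R) by (field; lra).
    assert (Hp : (0 < y / (y + 1))%R) by (apply Rdiv_lt_0_compat; lra).
    rewrite E, ln_Rinv by exact Hp.
    pose proof (exp_ineq1_le (ln (y / (y + 1)))) as Hl; rewrite exp_ln in Hl by exact Hp.
    replace (/ (y + 1))%R with (1 - y / (y + 1))%R by (field; lra); lra.
  - assert (Hp : (0 < (y + 1) / y)%R) by (apply Rdiv_lt_0_compat; lra).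
    pose proof (exp_ineq1_le (ln ((y + 1) / y))) as Hl; rewrite exp_ln in Hl by exact Hp.
    replace (/ y)%R with ((y + 1) / y - 1)%R by (field; lra); lra. }
induction k as [|k IH].
- rewrite Nat.add_0_r; simpl (INR 0).
  replace ((M + 0 + 1) / (M + 1))%R with 1%R by (field; lra).
  replace ((M + 0) / M)%R with 1%R by (field; lra).
  rewrite ln_1; lra.
- replace (S m + S k)%nat with (S (S m + k)) by lia.
  change (harmonic (S (S m + k))) with (harmonic (S m + k) + / INR (S (S m + k)))%R.
  rewrite (S_INR (S m + k)), (plus_INR (S m)), (S_INR k); fold M.
  pose proof (pos_INR k).
  replace ((M + (INR k + 1) + 1) / (M + 1))%R
    with (((M + INR k + 1) / (M + 1)) * ((M + INR k + 1 + 1) / (M + INR k + 1)))%R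
    by (field; lra).
  replace ((M + (INR k + 1)) / M)%R
    with (((M + INR k) / M) * ((M + INR k + 1) / (M + INR k)))%R by (field; lra).
  rewrite !ln_mult by (apply Rdiv_lt_0_compat; lra).
  pose proof (Hln (M + INR k)%R ltac:(lra)); pose proof (Hln (M + INR k + 1)%R ltac:(lra)).
  lra.
Qed.

(** The sum [1 - 1/2 + ... - 1/(2m)]: subtracting twice the even-index terms removes the harmonic
    sum up to [m]. *)
Definition alt_harmonic (m : nat) : R := (harmonic (2 * m) - harmonic m)%R.

Lemma alt_harmonic_lim : is_lim_seq alt_harmonic (ln 2).
Proof.
(* Shifting to [S m] keeps the denominators of the logarithmic bounds positive. *)
apply is_lim_seq_incr_1.
assert (H2 : is_lim_seq (fun m => 2 - / (INR (S m) + 1))%R 2%R).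
{ replace (Finite 2) with (Finite (2 - 0)) by (f_equal; ring).
  apply is_lim_seq_minus'; [apply is_lim_seq_const|].
  apply (is_lim_seq_incr_1 (fun m => / (INR m + 1))%R), is_lim_seq_inv_nat. }
apply is_lim_seq_le_le with (fun m => ln (2 - / (INR (S m) + 1))%R) (fun _ => ln 2).
- intros m; pose proof (harmonic_increment_bounds m (S m)) as H; unfold alt_harmonic.
  assert (HM : (0 < INR (S m))%R) by (apply lt_0_INR; lia).
  replace (2 * S m)%nat with (S m + S m)%nat by lia.
  replace ((INR (S m) + INR (S m) + 1) / (INR (S m) + 1))%R
    with (2 - / (INR (S m) + 1))%R in H by (field; lra).
  replace ((INR (S m) + INR (S m)) / INR (S m))%R with 2%R in H by (field; lra).
  exact H.
- apply is_lim_seq_continuous; [|exact H2].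
  apply derivable_continuous_pt; exists (/ 2)%R; apply derivable_pt_lim_ln; lra.
- apply is_lim_seq_const.
Qed.

(** Factors [2m+1] and [2m+2] are taken together: their exponentials add the next two alternating
    harmonic terms to the exponent, and their rational parts form one factor of [paired_prod]. *)
Lemma Cprod_tGamma_factor_double (x : C) (m : nat) : (0 < Re x)%R ->
  Cprod (tGamma_factor x) (2 * m) = Cexp (- (x * alt_harmonic m)) * paired_prod x m.
Proof.
intros Hx; induction m as [|m IH].
- unfold alt_harmonic, paired_prod; simpl; rewrite Rminus_0_r, Cmult_0_r, Copp_0, Cexp_0; ring.
- replace (2 * S m)%nat with (S (S (2 * m))) by lia.
  unfold paired_prod in *; rewrite !Cprod_S, IH.
  pose proof (pos_INR m) as Hm.
  assert (Ho : Nat.odd (S (2 * m)) = true)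
    by (apply Nat.odd_spec; exists m; lia).
  assert (He : Nat.odd (S (S (2 * m))) = false).
  { rewrite Nat.odd_succ, <- Nat.negb_odd, Ho; reflexivity. }
  unfold tGamma_factor; rewrite Ho, He; unfold tGamma_base.
  assert (Ea : alt_harmonic (S m) = (alt_harmonic m + / INR (S (2 * m)) - / INR (S (S (2 * m))))%R).
  { unfold alt_harmonic; replace (2 * S m)%nat with (S (S (2 * m))) by lia.
    change (harmonic (S (S (2 * m)))) with
      (harmonic (2 * m) + / INR (S (2 * m)) + / INR (S (S (2 * m))))%R.
    change (harmonic (S m)) with (harmonic m + / INR (S m))%R.
    rewrite !S_INR, mult_INR; simpl (INR 2); field; lra. }
  rewrite Ea.
  assert (E1 : INR (S (2 * m)) = (2 * INR m + 1)%R) by (rewrite S_INR, mult_INR; simpl (INR 2); ring).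
  assert (E2 : INR (S (S (2 * m))) = (2 * INR m + 2)%R) by (rewrite S_INR, E1; ring).
  rewrite E1, E2, S_INR.
  rewrite RtoC_minus, !RtoC_plus, !RtoC_inv, !RtoC_plus, !RtoC_mult by lra.
  set (M := RtoC (INR m)).
  assert (HM : (0 <= Re M)%R) by exact Hm.
  clearbody M.
  assert (N1 : 2 * M + 1 <> 0) by (apply Re_pos_neq_0; unfold Re in *; simpl; lra).
  assert (N2 : 2 * M + 2 <> 0) by (apply Re_pos_neq_0; unfold Re in *; simpl; lra).
  assert (N3 : 2 * M + 2 + x <> 0) by (apply Re_pos_neq_0; unfold Re in *; simpl; lra).
  replace (- (x * (alt_harmonic m + / (2 * M + 1) - / (2 * M + 2))))
    with (- (x * alt_harmonic m) + - (x / (2 * M + 1)) + - - (x / (2 * M + 2)))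
    by (field; split; assumption).
  (* The doubly negated exponent becomes the inverse exponential contributed by the even factor. *)
  rewrite !Cexp_plus, <- (Cinv_Cexp (- (x / (2 * M + 2)))).
  field; repeat split; try assumption; try apply Cexp_neq_0.
  all: apply Re_pos_neq_0; unfold Re in *; simpl; lra.
Qed.

(** Even partial products converge by the closed form; each odd one has a single extra factor, which
    tends to [1]. *)
Lemma Cprod_tGamma_factor_lim (x q : C) : (0 < Re x)%R -> Clim (paired_prod x) q ->
  Clim (Cprod (tGamma_factor x)) (Cexp (- (x * ln 2)) * q).
Proof.
intros Hx Hq.
assert (He : Clim (fun m => Cprod (tGamma_factor x) (2 * m)) (Cexp (- (x * ln 2)) * q)).
{ apply Clim_ext with (fun m => Cexp (- x * alt_harmonic m) * paired_prod x m).
  { intros m; rewrite Cprod_tGamma_factor_double by exact Hx.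
    f_equal; f_equal; ring. }
  apply Clim_mult; [|exact Hq].
  replace (- (x * ln 2)) with (- x * ln 2) by ring.
  apply (Clim_Cexp (fun m => - x * alt_harmonic m)), Clim_mult; [apply Clim_const|].
  apply Clim_RtoC, alt_harmonic_lim. }
apply Clim_even_odd; [exact He|].
apply Clim_ext with (fun m => Cprod (tGamma_factor x) (2 * m)
  * tGamma_base x (S (2 * m))).
{ intros m; replace (2 * m + 1)%nat with (S (2 * m)) by lia.
  rewrite Cprod_S; f_equal; unfold tGamma_factor.
  replace (Nat.odd (S (2 * m))) with true; [reflexivity|].
  symmetry; apply Nat.odd_spec; exists m; lia. }
rewrite <- (Cmult_1_r (_ * q)); apply Clim_mult; [exact He|].
assert (Hi : Clim (fun m => x * RtoC (/ (INR (2 * m) + 1))) (x * 0)).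
{ apply Clim_mult; [apply Clim_const|].
  apply (Clim_RtoC (fun m => / (INR (2 * m) + 1))%R).
  apply (is_lim_seq_double (fun m => / (INR m + 1))%R), is_lim_seq_inv_nat. }
apply Clim_ext with (fun m => Cexp (- (1) * (x * RtoC (/ (INR (2 * m) + 1))))
                              * (1 + x * RtoC (/ (INR (2 * m) + 1)))).
{ intros m; unfold tGamma_base; rewrite S_INR.
  pose proof (pos_INR (2 * m)).
  rewrite RtoC_inv by lra; f_equal; f_equal; unfold Cdiv; ring. }
(* The limit [1] is written as [exp (- y) * (1 + y)] at [y = 0], the shape produced by the limit
   rules. *)
replace (RtoC 1) with (Cexp (- (1) * (x * 0)) * (1 + x * 0)) at 1.
2: { rewrite !Cmult_0_r, Cexp_0; ring. }
apply Clim_mult.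
- apply (Clim_Cexp (fun m => - (1) * (x * RtoC (/ (INR (2 * m) + 1))))).
  apply Clim_mult; [apply Clim_const | exact Hi].
- apply Clim_plus; [apply Clim_const | exact Hi].
Qed.

Lemma tGamma_paired_prod (x q : C) : (0 < Re x)%R -> Clim (paired_prod x) q ->
  tGamma x = q / x.
Proof.
intros Hx Hq; unfold tGamma, Cinfprod.
rewrite (C_lim_seq_Clim _ _ (Cprod_tGamma_factor_lim x q Hx Hq)).
rewrite <- Cinv_Cexp; field; split; [now apply Re_pos_neq_0 | apply Cexp_neq_0].
Qed.

(** * Passage to the limit and the reflection formula *)

(** The finite identity is divided by [wallis (2m) * (2m+1)]; both sides then converge, and
    uniqueness of limits applies. *)
Lemma paired_prod_reflection (x q q' : C) : (0 < Re x < 1)%R ->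
  Clim (paired_prod x) q -> Clim (paired_prod (1 - x)) q' ->
  (1 - x) * q * Csin (PI * x / 2) = x * q' * Ccos (PI * x / 2).
Proof.
intros Hx Hq Hq'.
(* This is [(2m+1+x) / (2m+1)], the quotient of the two linear factors. *)
assert (Hn : Clim (fun m => 1 + x * RtoC (/ (INR (2 * m) + 1))) (1 + x * 0)).
{ apply Clim_plus; [apply Clim_const|]; apply Clim_mult; [apply Clim_const|].
  apply (Clim_RtoC (fun m => / (INR (2 * m) + 1))%R).
  apply (is_lim_seq_double (fun m => / (INR m + 1))%R), is_lim_seq_inv_nat. }
replace ((1 - x) * q * Csin (PI * x / 2))
  with ((1 - x) * q * 1 * (1 + x * 0) * Csin (PI * x / 2)) by ring.
replace (x * q' * Ccos (PI * x / 2)) with (x * q' * 1 * Ccos (PI * x / 2)) by ring.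
apply Clim_unique with (fun m => (1 - x) * paired_prod x m
  * (cos_integral x (2 * m + 1) / wallis (2 * m))
  * (1 + x * RtoC (/ (INR (2 * m) + 1))) * Csin (PI * x / 2)).
- repeat apply Clim_mult; try apply Clim_const; try assumption.
  apply cos_integral_odd_lim.
- apply Clim_ext with (fun m => x * paired_prod (1 - x) m
    * (cos_integral x (2 * m) / wallis (2 * m)) * Ccos (PI * x / 2)).
  + intros m; pose proof (paired_prod_cos_integral x m Hx) as H.
    pose proof (pos_INR m); pose proof (wallis_pos (2 * m)) as Hw.
    assert (NW : RtoC (wallis (2 * m)) <> 0) by (apply Re_pos_neq_0; rewrite re_RtoC; exact Hw).
    assert (NM : 2 * INR m + 1 <> 0) by (apply Re_pos_neq_0; simpl; lra).
    rewrite mult_INR; simpl (INR 2); replace (1 + 1)%R with 2%R by ring.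
    rewrite RtoC_inv, RtoC_plus, RtoC_mult by lra.
    transitivity (x * paired_prod (1 - x) m * cos_integral x (2 * m) * (2 * INR m + 1)
      * Ccos (PI * x / 2) / (wallis (2 * m) * (2 * INR m + 1))).
    { field; split; assumption. }
    rewrite <- H; field; split; assumption.
  + repeat apply Clim_mult; try apply Clim_const; try assumption.
    apply (Clim_double (fun m => cos_integral x m / wallis m)), cos_integral_lim.
Qed.

Theorem theorem2p19 (x : C) (hx0 : (0 < Re x)%R) (hx1 : (Re x < 1)%R) :
  tGamma x / tGamma (1 - x) = Ccot (PI * x / 2).
Proof.
assert (hx : (0 < Re (1 - x))%R) by (unfold Re in *; simpl; lra).
destruct (paired_prod_lim x hx0) as [q [_ Hq]].
destruct (paired_prod_lim (1 - x) hx) as [q' [Nq' Hq']].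
rewrite (tGamma_paired_prod x q), (tGamma_paired_prod (1 - x) q') by assumption.
pose proof (paired_prod_reflection x q q' (conj hx0 hx1) Hq Hq') as H.
pose proof (Re_pos_neq_0 x hx0) as Nx; pose proof (Re_pos_neq_0 _ hx) as Nx'.
(* If the sine vanished, the reflection identity would force the cosine to vanish as well, since [x]
   and [q'] are nonzero, contradicting [Ccos2_Csin2]. *)
assert (Ns : Csin (PI * x / 2) <> 0).
{ intros Es; pose proof (Ccos2_Csin2 (PI * x / 2)) as E.
  rewrite Es in H, E; rewrite !Cmult_0_r in H.
  assert (Ec : Ccos (PI * x / 2) = 0).
  { replace (Ccos (PI * x / 2)) with (x * q' * Ccos (PI * x / 2) / (x * q'))
      by (field; split; assumption).
    rewrite <- H; field; split; assumption. }
  rewrite Ec, !Cmult_0_r in E; apply (f_equal Re) in E; simpl in E; lra. }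
unfold Ccot.
transitivity ((1 - x) * q * Csin (PI * x / 2) / (x * q' * Csin (PI * x / 2))).
{ field; repeat split; assumption. }
rewrite H; field; repeat split; assumption.
Qed.
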